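(* Let $H^{(v)}$ be a rooted simple graph of order $m$ with root $v$. Let $D_v$ be the $m\times m$ diagonal matrix whose only nonzero entry is a $1$ in the diagonal position corresponding to $v$, let $B(\lambda)=A(H)+\lambda D_v$, and let $A^{(v)}(H)$ be the matrix obtained from $A(H)$ by deleting the row and column corresponding to $v$. Suppose that the following three conditions hold simultaneously: (i) $\mathrm{Res}\big(\phi(A(H);x),\phi(A^{(v)}(H);x)\big)=\pm 1$; (ii) $\det[e,B(\lambda)e,\ldots,(B(\lambda))^{m-1}e] =\pm \lambda^k$ (as a polynomial in $\lambda$) for some nonnegative integer $k$; (iii) either $\det A(H)=\pm 1$ and $\det A^{(v)}(H)=0$, or $\det A(H)=0$ and $\det A^{(v)}(H)=\pm 1$. Then $H^{(v)}$ is an $\mathcal{F}$-preserver, i.e., for every graph $G\in\mathcal{F}$, the rooted product $G\circ H^{(v)}$ also belongs to $\mathcal{F}$.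
   Context: $A(\cdot)$ denotes the adjacency matrix; $\phi(N;x)=\det(xI-N)$; $e$ is the all-ones vector. For a graph $G$ on $n$ vertices, the walk matrix is $W_A(G)=[e,A(G)e,\ldots,A(G)^{n-1}e]$. For polynomials $f=a_N\prod_{i=1}^N(x-\alpha_i)$ and $g=b_K\prod_{j=1}^K(x-\beta_j)$, $\mathrm{Res}(f,g)=a_N^K b_K^N\prod_{i,j}(\alpha_i-\beta_j)$. The rooted product $G\circ H^{(v)}$ of a graph $G$ with vertices $1,\dots,n$ and a rooted graph $H^{(v)}$ is obtained from $G$ and $n$ copies of $H$ by identifying the root $v$ of the $i$th copy with vertex $i$ of $G$, for each $i$. For an integer $n$, $\mathcal{F}_n$ is the set of all simple graphs $G$ on $n$ vertices with $\det A(G)=\pm1$ and $\det W_A(G)=\pm 2^{\lfloor n/2\rfloor}$, and $\mathcal{F}=\bigcup_n\mathcal{F}_n$. *)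

(* Defs.v *)
From mathcomp Require Import all_boot all_order all_algebra.

Set Implicit Arguments.
Unset Strict Implicit.
Unset Printing Implicit Defensive.

Import Order.TTheory GRing.Theory Num.Theory.
Local Open Scope ring_scope.

Record sgraph := SGraph {
  vertex :> finType;
  edge : rel vertex;
  edge_sym : symmetric edge;
  edge_irr : irreflexive edge }.

(* Rows and columns follow the canonical enumeration of the vertices; another
   numbering conjugates this matrix by a permutation matrix, which at most
   changes the sign of the determinant of the walk matrix. *)
Definition adjacency (G : sgraph) : 'M[int]_#|G| :=
  \matrix_(i, j) (edge (enum_val i) (enum_val j))%:R.

Definition walk_mx (R : pzRingType) (n : nat) (M : 'M[R]_n) : 'M[R]_n :=
  \matrix_(i, j) (M ^+ j *m const_mx 1 : 'cV[R]_n) i 0.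

Definition eq_pm (V : zmodType) (x y : V) : Prop := x = y \/ x = - y.

Definition in_Fn (n : nat) (G : sgraph) : Prop :=
  [/\ #|G| = n,
      eq_pm (\det (adjacency G)) 1 &
      eq_pm (\det (walk_mx (adjacency G))) (2 ^+ n./2)].

Definition in_F (G : sgraph) : Prop := exists n : nat, in_Fn n G.

Section RootedProduct.

Variables (G H : sgraph) (v : H).

(* (i, u) is the vertex u of the copy of H attached at the vertex i of G; the
   root (i, v) of that copy is the vertex i of G itself. *)
Definition rooted_edge : rel (G * H)%type := fun x y =>
  (x.1 == y.1) && edge x.2 y.2 || [&& x.2 == v, y.2 == v & edge x.1 y.1].

Lemma rooted_edge_sym : symmetric rooted_edge.
Proof.
move=> x y; rewrite /rooted_edge eq_sym (edge_sym x.2) (edge_sym x.1).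
by rewrite [in LHS]andbCA.
Qed.

Lemma rooted_edge_irr : irreflexive rooted_edge.
Proof. by move=> x; rewrite /rooted_edge !edge_irr !andbF. Qed.

Definition rooted_product : sgraph := SGraph rooted_edge_sym rooted_edge_irr.

End RootedProduct.

Section RootedGraph.

Variables (H : sgraph) (v : H).

Definition adjacency_del : 'M[int]_#|H|.-1 :=
  row' (enum_rank v) (col' (enum_rank v) (adjacency H)).

(* A(H) + lambda D_v, the indeterminate lambda being 'X : {poly int}. *)
Definition B_mx : 'M[{poly int}]_#|H| :=
  map_mx polyC (adjacency H) + 'X *: delta_mx (enum_rank v) (enum_rank v).

Definition F_preserver : Prop :=
  forall G : sgraph, in_F G -> in_F (rooted_product G v).

End RootedGraph.

(* Main.v *)
(* Write M for the adjacency matrix of the rooted product and A for that of G: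
   M is B(lambda) with lambda evaluated at A. Bezout from (i), combined with
   Cayley-Hamilton for B(lambda) over Z[lambda], shows that the block-diagonal
   action of A is a polynomial in M: it satisfies p(M) = A q(M) with q(M)
   invertible, p and q being the characteristic polynomials of H and H - v.
   As A is invertible, (ii) then says that the vectors M^k e span over Z the
   same lattice as the vectors A^j e (x) e_u, that is, as the columns of
   W_A(G) (x) I. Hence det W_A(G o H) = +- (det W_A(G))^m. The order n of G
   is even because det A is odd and A is alternating modulo 2. Finally (iii)
   makes det B(lambda) equal to +-1 or +- lambda, which becomes invertible at
   lambda = A. *)
Require Import Defs.
From mathcomp Require Import all_boot all_order all_algebra.

Set Implicit Arguments.
Unset Strict Implicit.
Unset Printing Implicit Defensive.

Import Order.TTheory GRing.Theory Num.Theory.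
Local Open Scope ring_scope.

(** * Matrix polynomials, characteristic polynomials and walk matrices *)

Lemma mulmx_cols (R : pzRingType) n p q (W : 'M[R]_(n, p)) (V : 'M[R]_(n, q)) :
  (forall j, exists c : 'cV[R]_p, col j V = W *m c) ->
  exists P : 'M[R]_(p, q), V = W *m P.
Proof.
case/fin_all_exists=> c hc; exists (\matrix_(i, j) c j i 0).
apply/matrixP=> i j; have /colP/(_ i) := hc j; rewrite !mxE => ->.
by apply: eq_bigr => k _; rewrite mxE.
Qed.

Lemma horner_mx_comp (R : comNzRingType) n (C : 'M[R]_n.+1) (p q : {poly R}) :
  horner_mx C (p \Po q) = horner_mx (horner_mx C q) p.
Proof.
elim/poly_ind: p => [|p c IHp]; first by rewrite comp_poly0 !rmorph0.
rewrite comp_polyD comp_polyM comp_polyX comp_polyC !rmorphD !rmorphM /=.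
by rewrite IHp horner_mx_X !horner_mx_C.
Qed.

(** The constant term of [char_poly Y] is [\det Y] up to sign, hence a unit, so Cayley-Hamilton
    yields an inverse that is a polynomial in [Y]. *)
Lemma horner_mx_inv (R : comNzRingType) n (Y Z : 'M[R]_n.+1) :
  Y *m Z = 1%:M -> exists h, Y *m horner_mx Y h = 1%:M.
Proof.
move=> YZ; have detYZ : \det Y * \det Z = 1 by rewrite -det_mulmx YZ det1.
have [h [c ch]] : exists h c, char_poly Y = h * 'X + c%:P.
  elim/poly_ind: (char_poly Y) => [|p c _]; last by exists p, c.
  by exists 0, 0; rewrite mul0r addr0.
have cE : c = (-1) ^+ n.+1 * \det Y.
  by rewrite -char_poly_det ch coefD coefMX coefC add0r.
have := Cayley_Hamilton Y; rewrite ch rmorphD rmorphM /= horner_mx_X horner_mx_C.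
move/eqP; rewrite addr_eq0 => /eqP hY.
exists ((- ((-1) ^+ n.+1 * \det Z))%:P * h).
rewrite rmorphM /= horner_mx_C [_ * horner_mx Y h]mul_scalar_mx -scalemxAr.
have -> : Y *m horner_mx Y h = horner_mx Y h *m Y.
  by apply: comm_mx_horner.
rewrite [_ *m Y]hY scalerN scaleNr opprK scale_scalar_mx cE.
rewrite mulrACA -exprMn mulrNN mulr1 expr1n mul1r mulrC detYZ //.
Qed.

Lemma det_add_delta (R : comPzRingType) n (C : 'M[R]_n) (r : 'I_n) (c : R) :
  \det (C + c *: delta_mx r r) = \det C + c * \det (row' r (col' r C)).
Proof.
rewrite (expand_det_row _ r) (expand_det_row C r).
have cof j : cofactor (C + c *: delta_mx r r) r j = cofactor C r j.
  congr (_ * \det _); apply/matrixP=> i k; rewrite !mxE.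
  by rewrite eq_sym (negbTE (neq_lift _ _)) mulr0 addr0.
under eq_bigr do rewrite cof !mxE mulrDl.
rewrite big_split /=; congr (_ + _).
rewrite (bigD1 r) //= big1 => [|j /negbTE jr]; last first.
  by rewrite jr andbF mulr0 mul0r.
by rewrite !eqxx mulr1 addr0 /cofactor addnn -signr_odd odd_double mul1r.
Qed.

(** Lambda is ['X%:P] here, the outer variable being that of the characteristic polynomial. It
    occurs in a single diagonal entry, so the determinant is affine in it. *)
Lemma char_poly_add_delta (R : comNzRingType) n (C : 'M[R]_n) (r : 'I_n) :
  char_poly (map_mx polyC C + 'X *: delta_mx r r) =
  map_poly polyC (char_poly C)
    - 'X%:P * map_poly polyC (char_poly (row' r (col' r C))).
Proof.
have mapE k (D : 'M[R]_k) : map_poly polyC (char_poly D) =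
    \det (char_poly_mx (map_mx polyC D)).
  rewrite -[LHS]/((map_poly polyC) (\det (char_poly_mx D))) -det_map_mx.
  congr (\det _); apply/matrixP=> i j; rewrite !mxE rmorphB rmorphMn /=.
  by rewrite map_polyX map_polyC.
rewrite !mapE -mulNr.
have -> : char_poly_mx (map_mx polyC (row' r (col' r C))) =
    row' r (col' r (char_poly_mx (map_mx polyC C))).
  by apply/matrixP=> i j; rewrite !mxE (inj_eq lift_inj).
rewrite -det_add_delta; congr (\det _).
apply/matrixP=> i j; rewrite !mxE rmorphD rmorphM /= opprD addrA mulNr.
by congr (_ - _ * _); case: (_ && _).
Qed.

(** The remainder of [g] modulo the monic [char_poly C] has the same value at [C] and degree at most
    [n]; its coefficients are the coordinates. *)
Lemma horner_walk_mx (R : comNzRingType) n (C : 'M[R]_n.+1) (g : {poly R}) :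
  exists c : 'cV[R]_n.+1, horner_mx C g *m const_mx 1 = walk_mx C *m c.
Proof.
have mon := char_poly_monic C.
pose r := Pdiv.Ring.rmodp g (char_poly C); exists (\col_i r`_i).
have -> : horner_mx C g = horner_mx C r.
  rewrite [in LHS](Pdiv.RingMonic.rdivp_eq mon g) rmorphD rmorphM /=.
  by rewrite Cayley_Hamilton mulr0 add0r.
have sr : (size r <= n.+1)%N.
  have := Pdiv.Ring.ltn_rmodp g (char_poly C).
  by rewrite monic_neq0 // size_char_poly ltnS.
have -> : horner_mx C r = \sum_(i < n.+1) r`_i *: C ^+ i.
  have {1}-> : r = \poly_(i < n.+1) r`_i.
    apply/polyP=> i; rewrite coef_poly; case: ltnP => // hi.
    by rewrite nth_default // (leq_trans sr).
  rewrite poly_def raddf_sum; apply: eq_bigr => i _.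
  by rewrite /= linearZ /= rmorphXn /= horner_mx_X.
apply/colP=> i; rewrite mulmx_suml summxE [RHS]mxE; apply: eq_bigr => j _.
by rewrite -scalemxAl !mxE mulrC.
Qed.

(** * Evaluation of matrices over [R[lambda]] at lambda = [A] *)

Section Lift.

Variables (R : comNzRingType) (n m N : nat) (A : 'M[R]_n.+1).
Variable f : 'I_N.+1 -> 'I_n.+1 * 'I_m.+1.
Hypothesis f_bij : bijective f.

(* Indices of the lifted matrices are read as pairs in 'I_n.+1 * 'I_m.+1 through
   f, and polynomial entries are evaluated at A. *)
Definition lift_mx (P : 'M[{poly R}]_m.+1) : 'M[R]_N.+1 :=
  \matrix_(x, y) horner_mx A (P (f x).2 (f y).2) (f x).1 (f y).1.

(** The values of this map form the span of the vectors [A^j e] placed in one block [u], the module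
    to be compared with the column span of the lifted walk matrix. *)
Definition lift_cv (p : 'cV[{poly R}]_m.+1) : 'cV[R]_N.+1 :=
  \col_x (horner_mx A (p (f x).2 0) *m const_mx 1 : 'cV[R]_n.+1) (f x).1 0.

(* The Kronecker product of W with the identity matrix of order m.+1. *)
Definition kron1_mx (W : 'M[R]_n.+1) : 'M[R]_N.+1 :=
  \matrix_(x, y) (W (f x).1 (f y).1 *+ ((f x).2 == (f y).2)).

Lemma reindex_pair (F : 'I_n.+1 * 'I_m.+1 -> R) :
  \sum_x F (f x) = \sum_u \sum_i F (i, u).
Proof.
rewrite exchange_big pair_bigA [RHS](reindex f) /=; last exact: onW_bij.
by apply: eq_bigr => x _; case: (f x).
Qed.

Lemma lift_mx_scalar (h : {poly R}) x y :
  lift_mx h%:M x y = horner_mx A h (f x).1 (f y).1 *+ ((f x).2 == (f y).2).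
Proof.
by rewrite !mxE; case: eqP => _; rewrite // mulr0n rmorph0 mxE.
Qed.

Lemma lift_mx_eq_scalar (h : {poly R}) c :
  horner_mx A h = c%:M -> lift_mx h%:M = c%:M.
Proof.
move=> hE; apply/matrixP=> x y; rewrite lift_mx_scalar hE !mxE.
by rewrite -mulrnA mulnb -(bij_eq f_bij x y) -pair_eqE.
Qed.

Lemma lift_mxC (c : R) : lift_mx c%:P%:M = c%:M.
Proof. by apply: lift_mx_eq_scalar; rewrite horner_mx_C. Qed.

Lemma lift_mxD P Q : lift_mx (P + Q) = lift_mx P + lift_mx Q.
Proof. by apply/matrixP=> x y; rewrite !mxE rmorphD mxE. Qed.

Lemma lift_mxM P Q : lift_mx (P *m Q) = lift_mx P *m lift_mx Q.
Proof.
apply/matrixP=> x y; rewrite [RHS]mxE.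
under eq_bigr do rewrite !mxE.
rewrite (reindex_pair (fun p => horner_mx A (P (f x).2 p.2) (f x).1 p.1 *
  horner_mx A (Q p.2 (f y).2) p.1 (f y).1)) /=.
rewrite !mxE rmorph_sum summxE; apply: eq_bigr => u _.
by rewrite rmorphM mxE.
Qed.

Lemma lift_cvM P p : lift_cv (P *m p) = lift_mx P *m lift_cv p.
Proof.
apply/colP=> x; rewrite [RHS]mxE.
under eq_bigr do rewrite [lift_mx _ _ _]mxE [lift_cv _ _ _]mxE.
rewrite (reindex_pair (fun q => horner_mx A (P (f x).2 q.2) (f x).1 q.1 *
  (horner_mx A (p q.2 0) *m const_mx 1 : 'cV_n.+1) q.1 0)) /=.
rewrite mxE [(P *m p) _ _]mxE rmorph_sum mulmx_suml summxE.
by apply: eq_bigr => u _; rewrite rmorphM -mulmxA [LHS]mxE.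
Qed.

Lemma lift_cv1 : lift_cv (const_mx 1) = const_mx 1.
Proof.
apply/colP=> x; rewrite [LHS]mxE [const_mx 1 _ 0]mxE rmorph1.
by rewrite [1 *m _]mul1mx !mxE.
Qed.

(** Only values at [A] matter, so lambda may be cancelled although it is not a unit of
    [{poly R}]. *)
Lemma eq_lift_cv (p q : 'cV[{poly R}]_m.+1) :
  (forall u, horner_mx A (p u 0) = horner_mx A (q u 0)) ->
  lift_cv p = lift_cv q.
Proof. by move=> pq; apply/colP=> x; rewrite !mxE pq. Qed.

Lemma lift_horner_mx (B : 'M[{poly R}]_m.+1) (g : {poly R}) :
  lift_mx (horner_mx B (map_poly polyC g)) = horner_mx (lift_mx B) g.
Proof.
elim/poly_ind: g => [|g c IHg].
  by rewrite !rmorph0; apply/matrixP=> x y; rewrite !mxE rmorph0 mxE.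
rewrite [map_poly _ _]rmorphD rmorphM /= map_polyX map_polyC /=.
rewrite !rmorphD !rmorphM /= !horner_mx_X !horner_mx_C.
by rewrite lift_mxD lift_mxM IHg lift_mxC.
Qed.

Lemma lift_mx_scalarE (h : {poly R}) :
  lift_mx h%:M = horner_mx (lift_mx 'X%:M) h.
Proof.
rewrite -lift_horner_mx; congr lift_mx.
elim/poly_ind: h => [|h c IHh]; first by rewrite !rmorph0.
rewrite [map_poly _ _]rmorphD rmorphM /= map_polyX map_polyC /=.
rewrite !rmorphD !rmorphM /= !horner_mx_X !horner_mx_C.
by rewrite -IHh.
Qed.

Lemma lift_mxX B k : lift_mx (B ^+ k) = lift_mx B ^+ k.
Proof.
elim: k => [|k IHk]; first exact: (lift_mx_eq_scalar (rmorph1 (horner_mx A))).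
by rewrite !exprS lift_mxM IHk.
Qed.

Lemma lift_cv_kron1 p :
  exists c, lift_cv p = kron1_mx (walk_mx A) *m c.
Proof.
have [c hc] := fin_all_exists (fun u => horner_walk_mx A (p u 0)).
exists (\col_x c (f x).2 (f x).1 0); apply/colP=> x; rewrite [LHS]mxE hc.
rewrite [RHS]mxE; under [RHS]eq_bigr => y _.
  rewrite [kron1_mx _ _ _]mxE [walk_mx _ _ _]mxE [(\col__ _) _ _]mxE; over.
rewrite (reindex_pair (fun q => ((A ^+ q.1 *m const_mx 1 : 'cV_n.+1) (f x).1 0
  *+ ((f x).2 == q.2)) * c q.2 q.1 0)) /=.
rewrite (bigD1 (f x).2) //= [X in _ + X]big1 ?addr0; last first.
  by move=> u /negbTE ux; apply: big1 => i _; rewrite eq_sym ux mulr0n mul0r.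
by rewrite mxE; apply: eq_bigr => i _; rewrite eqxx mxE.
Qed.

Lemma col_kron1_mx y :
  col y (kron1_mx (walk_mx A)) = lift_cv ('X^((f y).1) *: delta_mx (f y).2 0).
Proof.
apply/colP=> x; rewrite [LHS]mxE [LHS]mxE [walk_mx _ _ _]mxE [RHS]mxE.
rewrite [fun_of_matrix (_ *: _) _ _]mxE [delta_mx _ _ _ _]mxE eqxx andbT.
case: eqP => _; last by rewrite mulr0 rmorph0 [0 *m _]mul0mx [RHS]mxE.
by rewrite mulr1 rmorphXn /= horner_mx_X.
Qed.

Lemma col_walk_lift_mx B (j : 'I_N.+1) :
  col j (walk_mx (lift_mx B)) = lift_cv (B ^+ j *m const_mx 1).
Proof. by apply/colP=> x; rewrite lift_cvM lift_mxX lift_cv1 !mxE. Qed.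

(** The Bezout relation makes [u(M) L + v(M)] inverse to [q(M)]. Some [h(q(M))] is then also an
    inverse, and [p(M) = L q(M)] gives [L = p(M) h(q(M))]. *)
Lemma lift_indet_horner (B : 'M[{poly R}]_m.+1) (p q u v : {poly R}) :
  char_poly B = map_poly polyC p - 'X%:P * map_poly polyC q ->
  u * p + v * q = 1 ->
  exists l, lift_mx 'X%:M = horner_mx (lift_mx B) l.
Proof.
move=> chB bez; set M := lift_mx B; set L := lift_mx _.
have pL : horner_mx M p = L *m horner_mx M q.
  rewrite -!lift_horner_mx -lift_mxM; congr lift_mx.
  have := Cayley_Hamilton B; rewrite chB rmorphB rmorphM /= horner_mx_C.
  by move/subr0_eq.
have Zq : (horner_mx M u * L + horner_mx M v) * horner_mx M q = 1.
  by rewrite mulrDl -mulrA -[L * _]pL -!rmorphM -rmorphD bez rmorph1.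
have [h qh] := horner_mx_inv (mulmx1C Zq).
exists (p * (h \Po q)).
rewrite rmorphM /= horner_mx_comp pL -[L *m _]/(L * _) -mulrA.
by rewrite [X in _ * X]qh mulr1.
Qed.

Lemma lift_cv_walk (B : 'M[{poly R}]_m.+1) A' l k p :
  A *m A' = 1%:M -> lift_mx 'X%:M = horner_mx (lift_mx B) l ->
  eq_pm (\det (walk_mx B)) 'X^k ->
  exists c, lift_cv p = walk_mx (lift_mx B) *m c.
Proof.
move=> AA' Ll detW; have [h Ah] := horner_mx_inv AA'.
have {detW} [s detW ss] :
    exists2 s : {poly R}, \det (walk_mx B) = s * 'X^k & s * s = 1.
  by case: detW => ->; [exists 1 | exists (-1)]; rewrite ?mulrNN ?mul1r ?mulN1r.
(* The adjugate solves the system up to the factor [s * 'X^k]; since [s * s = 1] and [h(A)] inverts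
   [A], the scalar [s * h ^+ k] cancels it at [A]. *)
pose P := (s * h ^+ k) *: (\adj (walk_mx B) *m p).
have -> : lift_cv p = lift_cv (walk_mx B *m P).
  apply: eq_lift_cv => u.
  rewrite /P -scalemxAr mulmxA mul_mx_adj mul_scalar_mx scalerA !mxE.
  rewrite detW mulrACA ss mul1r -exprMn !rmorphM rmorphXn rmorphM /= horner_mx_X.
  have -> : horner_mx A h * A = 1 := mulmx1C Ah.
  by rewrite expr1n mul1r.
(* Lambda acts as [l(M)], so each coefficient [P j 0] becomes a polynomial in [M], and the whole
   combination is a single [g(M) e]. *)
pose g := \sum_(j < m.+1) (P j 0 \Po l) * 'X^j.
suff -> : lift_cv (walk_mx B *m P) = horner_mx (lift_mx B) g *m const_mx 1.
  exact: horner_walk_mx.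
have -> : walk_mx B *m P =
    \sum_(j < m.+1) ((P j 0)%:M *m (B ^+ j)) *m const_mx 1.
  apply/colP=> i; rewrite summxE mxE; apply: eq_bigr => j _.
  by rewrite mul_scalar_mx -scalemxAl !mxE mulrC.
rewrite -mulmx_suml lift_cvM lift_cv1; congr (_ *m _).
rewrite /g; elim/big_rec2: _ => [|j y1 y2 _ IH].
  by rewrite rmorph0; apply/matrixP=> x y; rewrite !mxE rmorph0 mxE.
rewrite lift_mxD IH rmorphD rmorphM /= rmorphXn /= horner_mx_X.
by rewrite lift_mxM lift_mxX lift_mx_scalarE Ll horner_mx_comp.
Qed.

Lemma walk_lift_mx_kron1 (B : 'M[{poly R}]_m.+1) A' l k :
  A *m A' = 1%:M -> lift_mx 'X%:M = horner_mx (lift_mx B) l ->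
  eq_pm (\det (walk_mx B)) 'X^k ->
  (exists P, walk_mx (lift_mx B) = kron1_mx (walk_mx A) *m P) /\
  (exists P, kron1_mx (walk_mx A) = walk_mx (lift_mx B) *m P).
Proof.
move=> AA' Ll detW; split; apply: mulmx_cols => j.
  by rewrite col_walk_lift_mx; apply: lift_cv_kron1.
by rewrite col_kron1_mx; apply: lift_cv_walk AA' Ll detW.
Qed.

Lemma kron1_mxM W V : kron1_mx (W *m V) = kron1_mx W *m kron1_mx V.
Proof.
apply/matrixP=> x y; rewrite [RHS]mxE.
under eq_bigr do rewrite [kron1_mx W _ _]mxE [kron1_mx V _ _]mxE.
rewrite (reindex_pair (fun q => (W (f x).1 q.1 *+ ((f x).2 == q.2)) *
  (V q.1 (f y).1 *+ (q.2 == (f y).2)))) /=.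
rewrite (bigD1 (f x).2) //= [X in _ + X]big1 ?addr0; last first.
  by move=> u /negbTE ux; apply: big1 => i _; rewrite eq_sym ux mulr0n mul0r.
rewrite mxE [(W *m V) _ _]mxE -sumrMnl; apply: eq_bigr => i _.
by rewrite eqxx mulrnAr.
Qed.

Lemma kron1_mx1 : kron1_mx 1%:M = 1%:M.
Proof.
apply/matrixP=> x y; rewrite !mxE -mulrnA mulnb -(bij_eq f_bij x y).
by rewrite -pair_eqE.
Qed.

Lemma det_kron1_diag (d : 'rV[R]_n.+1) :
  \det (kron1_mx (diag_mx d)) = \det (diag_mx d) ^+ m.+1.
Proof.
have -> : kron1_mx (diag_mx d) = diag_mx (\row_x d 0 (f x).1).
  apply/matrixP=> x y; rewrite !mxE -mulrnA mulnb -(bij_eq f_bij x y).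
  by rewrite -pair_eqE.
rewrite !det_diag -prodrXl; under eq_bigr do rewrite mxE.
rewrite [RHS](eq_bigr (fun i => \prod_(u < m.+1) d 0 i)); last first.
  by move=> i _; rewrite prodr_const card_ord.
rewrite pair_bigA [RHS](reindex f) //=; exact: onW_bij.
Qed.

End Lift.

(** * Integer determinants up to sign, and parity of the order *)

Lemma eq_pm_absz (x y : int) : eq_pm x y <-> `|x|%N = `|y|%N.
Proof.
split=> [[]->|]; rewrite ?abszN //.
move=> /(congr1 Posz); rewrite !abszE => /eqP; rewrite eqr_norm2.
by case/orP=> /eqP ->; [left | right].
Qed.

Lemma eq_pm1_mulr (x y : int) : eq_pm (x * y) 1 -> eq_pm x 1.
Proof.
move=> /eq_pm_absz; rewrite abszM => /eqP; rewrite muln_eq1 => /andP[/eqP ? _].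
exact/eq_pm_absz.
Qed.

Lemma absz_det_unitmx n (C : 'M[int]_n) : C \in unitmx -> `|\det C|%N = 1%N.
Proof.
move=> uC; have /eq_pm_absz -> // : eq_pm (\det C) 1.
apply: (@eq_pm1_mulr _ (\det (invmx C))); left.
by rewrite -det_mulmx mulmxV ?det1.
Qed.

(** The two determinants divide each other. *)
Lemma absz_det_mutual n (W V P Q : 'M[int]_n) :
  V = W *m P -> W = V *m Q -> `|\det V|%N = `|\det W|%N.
Proof.
move=> eV eW; apply/eqP; rewrite eqn_dvd; apply/andP; split.
  by rewrite [in X in (_ %| X)%N]eW det_mulmx abszM dvdn_mulr.
by rewrite [in X in (_ %| X)%N]eV det_mulmx abszM dvdn_mulr.
Qed.

(** Smith normal form reduces the claim to diagonal matrices, since the Kronecker product with the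
    identity keeps unimodular factors unimodular. *)
Lemma absz_det_kron1 n m N (f : 'I_N.+1 -> 'I_n.+1 * 'I_m.+1)
    (W : 'M[int]_n.+1) :
  bijective f -> `|\det (kron1_mx f W)|%N = (`|\det W| ^ m.+1)%N.
Proof.
move=> f_bij; have [L uL [D uD [d _ ->]]] := int_Smith_normal_form W.
have -> : \matrix_(i < n.+1, j < n.+1) (d`_i *+ (i == j :> nat)) =
    diag_mx (\row_i d`_i).
  by apply/matrixP=> i j; rewrite !mxE.
have u1 C : C \in unitmx -> `|\det (kron1_mx f C)|%N = 1%N.
  move=> uC; have /eq_pm_absz -> // : eq_pm (\det (kron1_mx f C)) 1.
  apply: (@eq_pm1_mulr _ (\det (kron1_mx f (invmx C)))); left.
  by rewrite -det_mulmx -kron1_mxM // mulmxV // kron1_mx1 // det1.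
rewrite !(kron1_mxM f_bij) !det_mulmx !abszM (u1 L) // (u1 D) //.
rewrite (absz_det_unitmx uL) (absz_det_unitmx uD) det_kron1_diag //.
by rewrite !mul1n !muln1 abszX.
Qed.

Lemma even_order_sym_det_pm1 n (C : 'M[int]_n) :
  C^T = C -> (forall i, C i i = 0) -> eq_pm (\det C) 1 -> ~~ odd n.
Proof.
move=> Csym C0 /eq_pm_absz detC; apply/negP=> n_odd.
(* Negating the lower triangle makes the matrix skew-symmetric without changing it modulo 2; in odd
   order its determinant vanishes, while [\det C] is odd. *)
pose K : 'M[int]_n := \matrix_(i, j) (if (i < j)%N then C i j else - C i j).
have KT : K^T = - K.
  apply/matrixP=> i j; rewrite !mxE -{1 2}Csym !mxE.
  by case: (ltngtP i j) => [| |/val_inj->]; rewrite ?opprK ?C0 ?oppr0.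
have detK : \det K = 0.
  have := det_tr K; rewrite KT -scaleN1r detZ -signr_odd n_odd expr1 mulN1r.
  by move=> /esym/eqP; rewrite -addr_eq0 -mulr2n mulrn_eq0 => /eqP.
have e : map_mx (intr : int -> 'F_2) C = map_mx intr K.
  apply/matrixP=> i j; rewrite !mxE; case: ifP => // _.
  by rewrite rmorphN /= oppr_pchar2.
have := det_map_mx (intr : {rmorphism int -> 'F_2}) C.
rewrite /= e det_map_mx detK rmorph0 => /esym.
by have /eq_pm_absz [->|->] : `|\det C|%N = `|1|%N by [].
Qed.

(** * From the conditions on [H] to the rooted product *)

Lemma bezout_resultant (R : comNzRingType) m (C : 'M[R]_m.+1) (D : 'M[R]_m) :
  eq_pm (resultant (char_poly C) (char_poly D)) 1 ->
  exists u v, u * char_poly C + v * char_poly D = 1.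
Proof.
case: m C D => [|m] C D hres.
  by exists 0, 1; rewrite mul0r add0r mul1r /char_poly det_mx00.
have [||[u v] _ /= uvE] := @resultant_in_ideal _ (char_poly C) (char_poly D);
  rewrite ?size_char_poly //.
case: hres uvE => -> uvE; first by exists u, v.
by exists (- u), (- v); rewrite !mulNr -opprD -uvE polyCN opprK.
Qed.

Lemma det_walk_rooted_product n m N (A : 'M[int]_n) (C : 'M[int]_m) (r : 'I_m)
    (f : 'I_N -> 'I_n * 'I_m) (M : 'M[int]_N)
    (B := map_mx polyC C + 'X *: delta_mx r r) (C' := row' r (col' r C)) :
  bijective f ->
  (forall x y, M x y = C (f x).2 (f y).2 *+ ((f x).1 == (f y).1) +
     A (f x).1 (f y).1 *+ (((f x).2 == r) && ((f y).2 == r))) ->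
  eq_pm (resultant (char_poly C) (char_poly C')) 1 ->
  (exists k, eq_pm (\det (walk_mx B)) 'X^k) ->
  eq_pm (\det C) 1 /\ \det C' = 0 \/ \det C = 0 /\ eq_pm (\det C') 1 ->
  eq_pm (\det A) 1 ->
  eq_pm (\det M) 1 /\ `|\det (walk_mx M)|%N = (`|\det (walk_mx A)| ^ m)%N.
Proof.
move=> f_bij ME res [k detW] detC detA.
(* The lifting needs nonempty index sets. For [n = 0] also [N = 0], and all the determinants
   involved equal 1. *)
case: n A f f_bij ME detA => [|n] A f f_bij ME detA.
  case: N f M f_bij ME => [|N] f M _ _; last by case: (f ord0) => -[].
  by rewrite !det_mx00 exp1n; split=> //; left.
case: m C r f @B @C' f_bij ME res detW detC => [|m] C r f B C'.
  by have := ltn_ord r.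
case: N f M => [|N] f M f_bij ME res detW detC.
  by case: f_bij => g _ _; case: (g (ord0, ord0)).
have MB : lift_mx A f B = M.
  have BE u w : B u w = (C u w)%:P + 'X *+ ((u == r) && (w == r)).
    by rewrite !mxE mulr_natr.
  apply/matrixP=> x y; rewrite [LHS]mxE BE rmorphD rmorphMn /=.
  rewrite horner_mx_C horner_mx_X ME.
  by case: (_ && _); rewrite ?mulr1n ?mulr0n !mxE.
have AA' : exists A', A *m A' = 1%:M.
  exists (invmx A); apply: mulmxV; rewrite unitmxE.
  by case: detA => ->; rewrite ?rpredN unitr1.
have [A' {}AA'] := AA'.
have detB : \det B = (\det C)%:P + 'X * (\det C')%:P.
  by rewrite det_add_delta -map_col' -map_row' !det_map_mx.
split.
  (* By (iii) [\det B] is a sign or a sign times lambda, so [w] is that sign, times [h] with [h(A)]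
     inverse to [A] in the second case. Lifting [w *: \adj B] then gives an integral inverse of
     [M]. *)
  have [w wB] : exists w, horner_mx A (w * \det B) = 1%:M.
    have [h Ah] := horner_mx_inv AA'; rewrite detB.
    case: detC => [[detC ->]|[-> detC]].
      exists (\det C)%:P; rewrite polyC0 mulr0 addr0 -polyCM horner_mx_C.
      by case: detC => ->; rewrite ?mulrNN mulr1.
    exists ((\det C')%:P * h).
    rewrite polyC0 add0r ['X * _]mulrC mulrACA [h * _]mulrC.
    have -> : (\det C')%:P * (\det C')%:P = 1.
      by rewrite -polyCM; case: detC => ->; rewrite ?mulrNN mulr1.
    by rewrite mul1r rmorphM /= horner_mx_X.
  apply: (@eq_pm1_mulr _ (\det (lift_mx A f (w *: \adj B)))); left.
  rewrite -MB -det_mulmx -lift_mxM // -scalemxAr mul_mx_adj scale_scalar_mx.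
  by rewrite (lift_mx_eq_scalar f_bij wB) det1.
have [u [v bez]] := bezout_resultant res.
have [l Ll] := lift_indet_horner A f_bij (char_poly_add_delta C r) bez.
have [[P eP] [Q eQ]] := walk_lift_mx_kron1 f_bij AA' Ll detW.
by rewrite -(absz_det_kron1 _ f_bij) -MB; apply: absz_det_mutual eP eQ.
Qed.

Theorem theorem4 (H : sgraph) (v : H)
  (hRes : eq_pm (resultant (char_poly (adjacency H))
                           (char_poly (adjacency_del v))) 1)
  (hWalk : exists k : nat, eq_pm (\det (walk_mx (B_mx v))) 'X^k)
  (hDet : (eq_pm (\det (adjacency H)) 1 /\ \det (adjacency_del v) = 0) \/
          (\det (adjacency H) = 0 /\ eq_pm (\det (adjacency_del v)) 1)) :
  F_preserver v.
Proof.
move=> G [n [<- detA detW]].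
pose f (x : 'I_#|rooted_product G v|) : 'I_#|G| * 'I_#|H| :=
  (enum_rank (enum_val x).1, enum_rank (enum_val x).2).
pose g (p : 'I_#|G| * 'I_#|H|) : 'I_#|rooted_product G v| :=
  enum_rank ((enum_val p.1, enum_val p.2) : rooted_product G v).
have f_bij : bijective f.
  exists g => [x | [i u]]; last by rewrite /f /g enum_rankK /= !enum_valK.
  by rewrite /f /g /= !enum_rankK -surjective_pairing enum_valK.
have ME x y : adjacency (rooted_product G v) x y =
    adjacency H (f x).2 (f y).2 *+ ((f x).1 == (f y).1) +
    adjacency G (f x).1 (f y).1 *+
      (((f x).2 == enum_rank v) && ((f y).2 == enum_rank v)).
  rewrite !mxE /= /rooted_edge !enum_rankK !(inj_eq enum_rank_inj) -!mulrnA.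
  (* The two kinds of edges exclude each other because [G] has no loops, so the disjunction becomes
     a sum. *)
  case: eqP => [->|_]; last by do 2 case: edge; do 2 case: (_ == v).
  by rewrite edge_irr !andbF orbF muln1 mul0n addr0; case: edge.
have [detM detWM] := det_walk_rooted_product f_bij ME hRes hWalk hDet detA.
exists #|rooted_product G v|; split=> //.
apply/eq_pm_absz; rewrite detWM; move/eq_pm_absz: detW => ->.
have evenG : ~~ odd #|G|.
  apply: even_order_sym_det_pm1 detA => [|i]; last by rewrite mxE edge_irr.
  by apply/matrixP=> i j; rewrite !mxE edge_sym.
(* Evenness of [#|G|] gives [(#|G| * #|H|)./2 = #|G|./2 * #|H|], which matches the exponents of
   2. *)
rewrite !abszX -expnM; congr (_ ^ _)%N.
by rewrite card_prod -[in RHS](even_halfK evenG) -doubleMl doubleK.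
Qed.
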